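(* Let $x\in\mathbb{R}^d$ and $i\in\{1,\dots,d\}$ with $g_i:=\nabla_i f(x)\ne0$. Suppose $\hat g_i$ is a real random variable with $\mathbb{E}\hat g_i=g_i$, variance $\sigma_i^2$, whose distribution is unimodal and symmetric (about $g_i$). Then $$\rho_i:=\mathrm{Prob}(\mathrm{sign}\,\hat g_i=\mathrm{sign}\,g_i)\ge\frac12+\frac12\frac{|g_i|}{|g_i|+\sqrt3\sigma_i}>\frac12.$$
   Context: $\mathrm{sign}\,t=1,0,-1$ for $t>0,t=0,t<0$. *)

(* Defs.v *)
(* real-valued random variable encoded by its distribution
   function F(t) = Prob(X <= t) (MathComp-analysis / measure theory is not
   installed; a probability distribution on R is the same thing as its CDF). *)
From Stdlib Require Import Reals Lra.
Open Scope R_scope.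

Definition right_cont (F : R -> R) (x : R) : Prop :=
  forall eps, 0 < eps -> exists delta, 0 < delta /\
    forall y, x <= y < x + delta -> Rabs (F y - F x) < eps.

(* L is the left limit of F at x, i.e. L = Prob(X < x) *)
Definition left_lim (F : R -> R) (x L : R) : Prop :=
  forall eps, 0 < eps -> exists delta, 0 < delta /\
    forall y, x - delta < y < x -> Rabs (F y - L) < eps.

Definition is_cdf (F : R -> R) : Prop :=
  (forall x y, x <= y -> F x <= F y) /\
  (forall x, right_cont F x) /\
  (forall eps, 0 < eps -> exists M, forall x, x <= M -> Rabs (F x) < eps) /\
  (forall eps, 0 < eps -> exists M, forall x, M <= x -> Rabs (F x - 1) < eps).

Definition improper_int_0_inf (h : R -> R) (I : R) : Prop :=
  forall eps, 0 < eps -> exists T0, forall T, T0 <= T ->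
    exists pr : Riemann_integrable h 0 T, Rabs (RiemannInt pr - I) < eps.

(* E X = mu, via E X = \int_0^oo P(X>t) dt - \int_{-oo}^0 P(X<=t) dt
   (both integrals finite) *)
Definition has_mean (F : R -> R) (mu : R) : Prop :=
  exists A B, improper_int_0_inf (fun t => 1 - F t) A /\
              improper_int_0_inf (fun t => F (- t)) B /\ mu = A - B.

(* E (X - mu)^2 = v, via E (X-mu)^2 = \int_0^oo 2t P(|X - mu| > t) dt;
   P(|X-mu|>t) = (1 - F(mu+t)) + P(X < mu-t), and P(X < mu - t) differs from
   F(mu - t) only at countably many t, which does not change the integral. *)
Definition has_variance (F : R -> R) (mu v : R) : Prop :=
  improper_int_0_inf (fun t => 2 * t * (1 - F (mu + t) + F (mu - t))) v.

(* distribution symmetric about m: P(X <= m - t) = P(X >= m + t) for all t *)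
Definition symmetric_about (F : R -> R) (m : R) : Prop :=
  forall t L, left_lim F (m + t) L -> F (m - t) = 1 - L.

(* unimodal with mode m (Khintchine): F convex on (-oo,m), concave on (m,oo) *)
Definition unimodal_at (F : R -> R) (m : R) : Prop :=
  (forall x y l, x < m -> y < m -> 0 <= l <= 1 ->
     F (l * x + (1 - l) * y) <= l * F x + (1 - l) * F y) /\
  (forall x y l, m < x -> m < y -> 0 <= l <= 1 ->
     l * F x + (1 - l) * F y <= F (l * x + (1 - l) * y)).


(* rho = Prob(sign X = sign g) for g <> 0:
   g > 0 : rho = P(X > 0) = 1 - F 0 ;  g < 0 : rho = P(X < 0) = F(0-) *)
Definition sign_agree_prob (F : R -> R) (g rho : R) : Prop :=
  (0 < g -> rho = 1 - F 0) /\ (g < 0 -> left_lim F 0 rho).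

(* Main.v *)
(* Write a = |g| and q = F(g - a), so that rho = 1 - q by symmetry.  Convexity of F left of
   the mode g gives a supporting line at g - a: F(g - t) >= c - m t with m >= 0 and
   c = q + m a, and by symmetry the right tail 1 - F(g + t) obeys the same bound, which also
   forces c <= 1/2.  Comparing the variance with the integral of 4 t (c - m t) up to t = c/m
   gives 3 sigma^2 m^2 >= 2 c^3 >= 4 c^4, i.e. sqrt 3 sigma m >= 2 c^2; with a m = c - q
   this rearranges to 2 q (a + sqrt 3 sigma) <= sqrt 3 sigma.  (If m = 0 the tails do not
   decay and a finite variance forces q = 0.) *)

Require Import Defs.
From Stdlib Require Import Reals Lra Classical.
From Coquelicot Require Import Coquelicot.
Open Scope R_scope.

Lemma cdf_bounds F : is_cdf F -> forall x, 0 <= F x <= 1.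
Proof.
  intros [F_mono [_ [F_left F_right]]] x. split.
  - apply Rnot_lt_le; intro Hneg.
    destruct (F_left (- F x)) as [M HM]; [lra|].
    assert (HMx := HM (Rmin M x) (Rmin_l M x)).
    assert (HmonoM := F_mono _ _ (Rmin_r M x)).
    apply Rabs_def2 in HMx. lra.
  - apply Rnot_lt_le; intro Hbig.
    destruct (F_right (F x - 1)) as [M HM]; [lra|].
    assert (HMx := HM (Rmax M x) (Rmax_l M x)).
    assert (HmonoM := F_mono _ _ (Rmax_r M x)).
    apply Rabs_def2 in HMx. lra.
Qed.

Lemma nondecreasing_left_lim F M x :
  (forall u v, u <= v -> F u <= F v) -> (forall y, F y <= M) ->
  exists L, left_lim F x L /\ forall y, y < x -> F y <= L.
Proof.
  intros F_mono F_le.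
  set (E := fun v => exists y, y < x /\ v = F y).
  assert (E_bound : bound E) by (exists M; intros v [y [_ ->]]; apply F_le).
  assert (E_inhabited : exists v, E v) by (exists (F (x - 1)), (x - 1); split; [lra|auto]).
  destruct (completeness E E_bound E_inhabited) as [L [L_ub L_least]].
  exists L. split.
  - intros eps Heps.
    destruct (classic (exists y, y < x /\ L - eps < F y)) as [[y0 [Hy0 HFy0]]|Hnone].
    + exists (x - y0). split; [lra|]. intros y Hy.
      assert (F y0 <= F y) by (apply F_mono; lra).
      assert (F y <= L) by (apply L_ub; exists y; split; [lra|auto]).
      apply Rabs_def1; lra.
    + assert (L <= L - eps); [|lra].
      apply L_least. intros v [y [Hy ->]].
      apply Rnot_lt_le. intro. apply Hnone. now exists y.
  - intros y Hy. apply L_ub. now exists y.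
Qed.

Lemma symmetric_cdf_tail F g : is_cdf F -> symmetric_about F g ->
  forall s t, s < t -> F (g - t) <= 1 - F (g + s).
Proof.
  intros HF Hsym s t Hst.
  destruct (nondecreasing_left_lim F 1 (g + t)) as [L [HL L_ub]];
    [apply HF | apply cdf_bounds, HF |].
  rewrite (Hsym t L HL).
  assert (F (g + s) <= L) by (apply L_ub; lra). lra.
Qed.

Lemma sign_agree_prob_symmetric F g rho : g <> 0 -> symmetric_about F g ->
  sign_agree_prob F g rho -> rho = 1 - F (g - Rabs g).
Proof.
  intros Hg Hsym [Hpos Hneg].
  destruct (Rtotal_order g 0) as [Hlt|[Heq|Hgt]]; [|contradiction|].
  - rewrite Rabs_left by exact Hlt.
    assert (HL := Hsym (- g) rho). replace (g + - g) with 0 in HL by ring.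
    rewrite (HL (Hneg Hlt)). ring.
  - rewrite Rabs_right, Rminus_diag by lra. auto.
Qed.

Section ConvexBelow.

Variables (F : R -> R) (g : R).
Hypothesis F_mono : forall x y, x <= y -> F x <= F y.
Hypothesis F_convex : forall x y l, x < g -> y < g -> 0 <= l <= 1 ->
  F (l * x + (1 - l) * y) <= l * F x + (1 - l) * F y.

Lemma chord_slope_le x b y : x < b -> b < y -> y < g ->
  (F b - F x) / (b - x) <= (F y - F b) / (y - b).
Proof.
  intros Hxb Hby Hyg.
  set (l := (y - b) / (y - x)).
  assert (Hl : l * (y - x) = y - b) by (unfold l; field; lra).
  assert (Hl01 : 0 <= l <= 1) by (split; nra).
  assert (Hconv := F_convex x y l ltac:(lra) ltac:(lra) Hl01).
  replace (l * x + (1 - l) * y) with b in Hconv by (unfold l; field; lra).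
  assert (Hcross : (F b - F x) * (y - b) <= (F y - F b) * (b - x)) by nra.
  apply Rmult_le_reg_r with ((b - x) * (y - b)); [nra|].
  replace ((F b - F x) / (b - x) * ((b - x) * (y - b))) with ((F b - F x) * (y - b))
    by (field; lra).
  replace ((F y - F b) / (y - b) * ((b - x) * (y - b))) with ((F y - F b) * (b - x))
    by (field; lra).
  exact Hcross.
Qed.

(* The slope [m] is the supremum of the chord slopes from the left of [b]. *)
Lemma supporting_line b : b < g ->
  exists m, 0 <= m /\ forall y, y < g -> F b + m * (y - b) <= F y.
Proof.
  intros Hbg.
  set (E := fun s => exists x, x < b /\ s = (F b - F x) / (b - x)).
  assert (E_bound : bound E).
  { exists ((F ((b + g) / 2) - F b) / ((b + g) / 2 - b)).
    intros s [x [Hx ->]]. apply chord_slope_le; lra. }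
  assert (E_unit : E (F b - F (b - 1))).
  { exists (b - 1). split; [lra|]. replace (b - (b - 1)) with 1 by ring. field. }
  destruct (completeness E E_bound (ex_intro _ _ E_unit)) as [m [m_ub m_least]].
  exists m. split.
  - assert (F (b - 1) <= F b) by (apply F_mono; lra).
    assert (F b - F (b - 1) <= m) by (apply m_ub; exact E_unit). lra.
  - intros y Hyg. destruct (Rtotal_order y b) as [Hyb|[->|Hby]].
    + assert (Hs : (F b - F y) / (b - y) <= m) by (apply m_ub; now exists y).
      assert (F b - F y = (F b - F y) / (b - y) * (b - y)) by (field; lra).
      nra.
    + lra.
    + assert (Hs : m <= (F y - F b) / (y - b)).
      { apply m_least. intros s [x [Hx ->]]. apply chord_slope_le; lra. }
      assert (F y - F b = (F y - F b) / (y - b) * (y - b)) by (field; lra).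
      nra.
Qed.

End ConvexBelow.

Lemma affine_le_of_forall_gt c m t A : 0 <= m ->
  (forall s, t < s -> c - m * s <= A) -> c - m * t <= A.
Proof.
  intros Hm Hgt. apply Rnot_lt_le; intro Hlt.
  set (d := c - m * t - A).
  assert (Hstep : 0 < d / (2 * (m + 1))) by (apply Rdiv_lt_0_compat; unfold d; lra).
  assert (Hd : d / (2 * (m + 1)) * (2 * (m + 1)) = d) by (field; lra).
  assert (Hgt' := Hgt (t + d / (2 * (m + 1))) ltac:(lra)).
  unfold d in *. nra.
Qed.

Lemma is_RInt_tent c m T :
  is_RInt (fun t => 4 * t * (c - m * t)) 0 T (2 * c * T ^ 2 - 4 / 3 * m * T ^ 3).
Proof.
  replace (2 * c * T ^ 2 - 4 / 3 * m * T ^ 3)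
    with (minus (2 * c * T ^ 2 - 4 / 3 * m * T ^ 3) (2 * c * 0 ^ 2 - 4 / 3 * m * 0 ^ 3))
    by (unfold minus, plus, opp; simpl; ring).
  apply (is_RInt_derive (fun t => 2 * c * t ^ 2 - 4 / 3 * m * t ^ 3)).
  - intros x _. auto_derive; [easy | field].
  - intros x _. apply (@ex_derive_continuous R_AbsRing R_NormedModule). auto_derive. easy.
Qed.

Lemma improper_int_0_inf_ge (h k : R -> R) (V T Ik : R) :
  (forall t, 0 < t -> 0 <= h t) -> improper_int_0_inf h V ->
  0 <= T -> is_RInt k 0 T Ik -> (forall t, 0 < t < T -> k t <= h t) -> Ik <= V.
Proof.
  intros h_ge0 HV HT Hk k_le_h.
  apply le_epsilon; intros eps Heps.
  destruct (HV eps Heps) as [T0 HT0].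
  destruct (HT0 (Rmax T T0) (Rmax_r _ _)) as [pr Hpr].
  set (T' := Rmax T T0) in *.
  assert (HTT' : T <= T') by apply Rmax_l.
  rewrite <- RInt_Reals in Hpr. apply Rabs_def2 in Hpr.
  assert (Hh : ex_RInt h 0 T') by exact (ex_RInt_Reals_1 _ _ _ pr).
  assert (Hh1 : ex_RInt h 0 T) by (apply (@ex_RInt_Chasles_1 R_CompleteNormedModule _ _ _ T'); auto; lra).
  assert (Hh2 : ex_RInt h T T') by (apply (@ex_RInt_Chasles_2 R_CompleteNormedModule _ 0); auto; lra).
  assert (Hsplit := @RInt_Chasles R_CompleteNormedModule h 0 T T' Hh1 Hh2).
  assert (Htail : 0 <= RInt h T T') by (apply RInt_ge_0; auto; intros x Hx; apply h_ge0; lra).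
  assert (Hhead : Ik <= RInt h 0 T) by (apply (is_RInt_le k h 0 T); auto; apply (@RInt_correct R_CompleteNormedModule), Hh1).
  unfold plus in Hsplit; simpl in Hsplit. lra.
Qed.

Lemma nonpos_of_bounded_quadratic c V :
  (forall T, 0 <= T -> c * T ^ 2 <= V) -> c <= 0.
Proof.
  intros Hbound. apply Rnot_lt_le; intro Hc.
  assert (HV := Hbound 0 (Rle_refl 0)).
  set (T := (V + 1) / c + 1).
  assert (HcT : c * T = V + 1 + c) by (unfold T; field; lra).
  assert (HT : 1 <= T) by (unfold T; assert (0 <= (V + 1) / c) by (apply Rdiv_le_0_compat; lra); lra).
  assert (HT2 := Hbound T ltac:(lra)). nra.
Qed.

Lemma tent_peak_bound c m V : 0 < m -> 0 <= c ->
  (forall T, 0 <= T -> 2 * c * T ^ 2 - 4 / 3 * m * T ^ 3 <= V) ->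
  2 * c ^ 3 <= 3 * V * m ^ 2.
Proof.
  intros Hm Hc Hbound.
  assert (Hpeak := Hbound (c / m) ltac:(apply Rdiv_le_0_compat; lra)).
  replace (2 * c * (c / m) ^ 2 - 4 / 3 * m * (c / m) ^ 3) with (2 / 3 * c ^ 3 / m ^ 2)
    in Hpeak by (field; lra).
  apply Rmult_le_reg_r with (/ m ^ 2); [apply Rinv_0_lt_compat; nra|].
  replace (3 * V * m ^ 2 * / m ^ 2) with (3 * V) by (field; lra).
  unfold Rdiv in Hpeak. lra.
Qed.

Lemma sign_error_bound q a m sigma :
  0 <= q -> 0 < a -> 0 <= m -> 0 <= sigma -> q + m * a <= 1 / 2 ->
  (forall T, 0 <= T -> 2 * (q + m * a) * T ^ 2 - 4 / 3 * m * T ^ 3 <= sigma ^ 2) ->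
  2 * q * (a + sqrt 3 * sigma) <= sqrt 3 * sigma.
Proof.
  intros Hq Ha Hm Hsigma Hc Hbound.
  set (w := sqrt 3 * sigma). set (c := q + m * a) in *.
  assert (Hw : 0 <= w) by (apply Rmult_le_pos; [apply sqrt_pos | exact Hsigma]).
  assert (Hw2 : w ^ 2 = 3 * sigma ^ 2).
  { unfold w. rewrite Rpow_mult_distr, pow2_sqrt; lra. }
  destruct (Req_dec m 0) as [Hm0|Hm0].
  - assert (Hq0 : 2 * q <= 0).
    { apply (nonpos_of_bounded_quadratic _ (sigma ^ 2)). intros T HT.
      specialize (Hbound T HT). unfold c in Hbound. rewrite Hm0 in Hbound. lra. }
    nra.
  - assert (Hc0 : 0 <= c) by (unfold c; nra).
    assert (Hpeak := tent_peak_bound c m (sigma ^ 2) ltac:(lra) Hc0 Hbound).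
    assert (Hwm : 2 * c ^ 2 <= w * m).
    { assert (Hc3 : 0 <= c ^ 3) by (apply pow_le, Hc0).
      assert (Hsq : (2 * c ^ 2) ^ 2 <= (w * m) ^ 2).
      { replace ((w * m) ^ 2) with (w ^ 2 * m ^ 2) by ring. rewrite Hw2.
        replace ((2 * c ^ 2) ^ 2) with (2 * c * (2 * c ^ 3)) by ring. nra. }
      apply Rsqr_incr_0_var; unfold Rsqr; nra. }
    assert (Hq_le_c : q <= c) by (unfold c; nra).
    assert (Hkey : 2 * q * (c - q) <= 2 * c ^ 2 * (1 - 2 * q)).
    { assert (0 <= q * c * (1 - 2 * c)) by (apply Rmult_le_pos; nra).
      assert (0 <= (c - q) ^ 2) by apply pow2_ge_0. nra. }
    assert (Hscaled : 2 * c ^ 2 * (1 - 2 * q) <= w * m * (1 - 2 * q))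
      by (apply Rmult_le_compat_r; lra).
    assert (Ham : a * m = c - q) by (unfold c; ring).
    apply Rmult_le_reg_l with m; [lra|]. nra.
Qed.

Lemma half_plus_ratio_le q a w : 0 < a -> 0 <= w -> 2 * q * (a + w) <= w ->
  1 / 2 + 1 / 2 * (a / (a + w)) <= 1 - q.
Proof.
  intros Ha Hw Hq.
  assert (Hratio : a / (a + w) * (a + w) = a) by (field; lra).
  nra.
Qed.

Theorem lemma1 (F : R -> R) (g sigma : R) :
  g <> 0 -> 0 <= sigma ->
  is_cdf F ->
  has_mean F g ->
  has_variance F g (sigma ^ 2) ->
  symmetric_about F g ->
  unimodal_at F g ->
  forall rho, sign_agree_prob F g rho ->
    1/2 + 1/2 * (Rabs g / (Rabs g + sqrt 3 * sigma)) <= rho /\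
    1/2 < 1/2 + 1/2 * (Rabs g / (Rabs g + sqrt 3 * sigma)).
Proof.
  intros Hg Hsigma HF _ Hvar Hsym [Hconvex _] rho Hrho.
  assert (F_bounds := cdf_bounds F HF).
  set (a := Rabs g). assert (Ha : 0 < a) by (apply Rabs_pos_lt, Hg).
  set (q := F (g - a)).
  destruct (supporting_line F g (proj1 HF) Hconvex (g - a) ltac:(lra)) as [m [Hm Hline]].
  set (c := q + m * a).
  assert (Hleft : forall t, 0 < t -> c - m * t <= F (g - t)).
  { intros t Ht. assert (H := Hline (g - t) ltac:(lra)). unfold c, q. lra. }
  assert (Hright : forall t, 0 <= t -> c - m * t <= 1 - F (g + t)).
  { intros t Ht. apply affine_le_of_forall_gt; [exact Hm|]. intros s Hs.
    apply Rle_trans with (F (g - s)); [apply Hleft; lra|].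
    apply symmetric_cdf_tail; auto. }
  assert (Hc : c - m * 0 <= 1 / 2).
  { apply affine_le_of_forall_gt; [exact Hm|]. intros t Ht.
    assert (Hhalf := symmetric_cdf_tail F g HF Hsym (- t) t ltac:(lra)).
    replace (g + - t) with (g - t) in Hhalf by ring.
    assert (Ht' := Hleft t Ht). lra. }
  assert (Hprofile : forall T, 0 <= T -> 2 * c * T ^ 2 - 4 / 3 * m * T ^ 3 <= sigma ^ 2).
  { intros T HT.
    eapply improper_int_0_inf_ge; [| exact Hvar | exact HT | apply is_RInt_tent |].
    - intros t Ht. simpl.
      assert (Hplus := F_bounds (g + t)). assert (Hminus := F_bounds (g - t)).
      apply Rmult_le_pos; lra.
    - intros t Ht. assert (Hl := Hleft t ltac:(lra)). assert (Hr := Hright t ltac:(lra)).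
      nra. }
  assert (Herr := sign_error_bound q a m sigma ltac:(apply F_bounds) Ha Hm Hsigma
    ltac:(fold c; lra) Hprofile).
  rewrite (sign_agree_prob_symmetric F g rho Hg Hsym Hrho). fold a q.
  assert (Hw : 0 <= sqrt 3 * sigma) by (apply Rmult_le_pos; [apply sqrt_pos | exact Hsigma]).
  split; [now apply half_plus_ratio_le|].
  assert (0 < a / (a + sqrt 3 * sigma)) by (apply Rdiv_lt_0_compat; lra). lra.
Qed.
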